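(* For every $t\in\mathbb N$ one has $|H^{t+1}|=\mathcal C_{t+1}$, where $\mathcal C_m=\frac{(2m)!}{m!\,(m+1)!}$ is the $m$-th Catalan number. Moreover, for every $j$ with $1\le j\le t+1$, $$|H^{t+1}_j|=\mathcal C_{j-1}\,\mathcal C_{t-j+1}.$$
   Context: A diagram of order $n\ge 1$ is a tuple $\mathscr D=(h_1,\dots,h_n)$ of non-negative integers; $h_i$ is the height of the $i$-th column $C_i$ (a stack of $h_i$ unit blocks at heights $1,\dots,h_i$), and $\operatorname{ht}\mathscr D=\max_i h_i$. A column $C_i$ is left (resp. right) extremal if $h_l<h_i$ for all $l<i$ (resp. all $l>i$). The diagram satisfies the boundary conditions if every left extremal column has even height or height $\operatorname{ht}\mathscr D$, and every right extremal column has odd height or height $\operatorname{ht}\mathscr D$; only such diagrams are considered. With $r=\operatorname{ht}\mathscr D$, the strongly extremal column is the leftmost column of height $r$ if $r$ is odd and the rightmost column of height $r$ if $r$ is even (for the empty diagram it is $C_n$). Operations: (a) domino adjunction: replace $h_i=h$ by $h+2$, allowed if either $h$ is even and there is $l>i$ with $h_l\ge h+2$ and $h_m\le h$ for all $i<m<l$, or $h$ is odd and there is $l<i$ with $h_l\ge h+2$ and $h_m\le h$ for all $l<m<i$; (b) half-domino adjunction: increase the height of the strongly extremal column by $1$; (c) row cancellation: if for some $k\ge1$ no column has height exactly $k$ (i.e. rows $k$ and $k+1$ have the same number of blocks), subtract $2$ from every column of height $\ge k+1$. These operations and their inverses preserve the boundary conditions; they generate an equivalence relation on diagrams of order $n$.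 $H^n$ denotes the set of equivalence classes of diagrams of order $n$. The index $j$ of the strongly extremal column is constant on each class, and $H^n_j\subseteq H^n$ is the set of classes whose strongly extremal column is $C_j$. *)

(* Defs.v *)
From HB Require Import structures.
From mathcomp Require Import all_boot.
From mathcomp Require Import boolp classical_sets functions cardinality.
From Stdlib Require Import Relation_Operators.
From mathcomp Require Import zify.

Set Implicit Arguments.
Unset Strict Implicit.
Unset Printing Implicit Defensive.

Local Open Scope nat_scope.
Local Open Scope classical_set_scope.

(* Columns are indexed from 0: [D i], for [i : 'I_n], is the height
   $h_{i+1}$ of the column $C_{i+1}$. *)
Definition ht n (D : {ffun 'I_n -> nat}) : nat := \max_(i < n) D i.

Definition left_extremal n (D : {ffun 'I_n -> nat}) (i : 'I_n) : bool :=
  [forall l : 'I_n, (l < i) ==> (D l < D i)].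

Definition right_extremal n (D : {ffun 'I_n -> nat}) (i : 'I_n) : bool :=
  [forall l : 'I_n, (i < l) ==> (D l < D i)].

Definition boundary n (D : {ffun 'I_n -> nat}) : bool :=
  [forall i : 'I_n,
     (left_extremal D i ==> ~~ odd (D i) || (D i == ht D)) &&
     (right_extremal D i ==> odd (D i) || (D i == ht D))].

Record diagram (n : nat) := Diagram {
  heights :> {ffun 'I_n -> nat};
  diagram_boundary : boundary heights
}.

HB.instance Definition _ n := [isSub for @heights n].
HB.instance Definition _ n := [Choice of diagram n by <:].

(* Among the columns of maximal height, the left (resp. right) extremal one
   is the leftmost (resp. rightmost).  The empty diagram has even height 0, so
   that its strongly extremal column is the last one. *)
Definition strongly_extremal n (D : {ffun 'I_n -> nat}) (i : 'I_n) : bool :=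
  (D i == ht D) &&
  (if odd (ht D) then left_extremal D i else right_extremal D i).

Definition domino_addable n (D : {ffun 'I_n -> nat}) (i : 'I_n) : Prop :=
  (~~ odd (D i) /\
     exists l : 'I_n, [/\ i < l, D i + 2 <= D l &
       forall m : 'I_n, i < m < l -> D m <= D i])
  \/
  (odd (D i) /\
     exists l : 'I_n, [/\ l < i, D i + 2 <= D l &
       forall m : 'I_n, l < m < i -> D m <= D i]).

Definition domino_adjunction n (D D' : {ffun 'I_n -> nat}) : Prop :=
  exists i : 'I_n, domino_addable D i /\
    D' = [ffun k => if k == i then D k + 2 else D k].

Definition half_domino_adjunction n (D D' : {ffun 'I_n -> nat}) : Prop :=
  exists i : 'I_n, strongly_extremal D i /\
    D' = [ffun k => if k == i then D k + 1 else D k].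

(* The subtraction is never truncated, as [2 <= k + 1 <= D i] there. *)
Definition row_cancellation n (D D' : {ffun 'I_n -> nat}) : Prop :=
  exists k : nat, [/\ 1 <= k, forall i, D i <> k &
    D' = [ffun i => if k + 1 <= D i then D i - 2 else D i]].

(* Both sides satisfy the boundary conditions.  This only matters for undoing
   row cancellations: (1, 3) cancels to (1, 1), but only the latter satisfies
   them. *)
Definition step n (D D' : diagram n) : Prop :=
  [\/ domino_adjunction D D', half_domino_adjunction D D'
    | row_cancellation D D'].

Definition diagram_equiv n : diagram n -> diagram n -> Prop :=
  clos_refl_sym_trans (diagram n) (@step n).

Definition diagram_class n (D : diagram n) : set (diagram n) :=
  [set D' | diagram_equiv D D'].

Definition Hset (n : nat) : set (set (diagram n)) :=
  [set E | exists D : diagram n, E = diagram_class D].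
Arguments Hset : clear implicits.

Definition Hset_at n (j : 'I_n) : set (set (diagram n)) :=
  [set E | Hset n E /\ forall D : diagram n, E D -> strongly_extremal D j].

Definition catalan (m : nat) : nat := (2 * m)`! %/ (m`! * m.+1`!).

(* The division in [catalan] is exact. *)
Lemma catalanK m : catalan m * (m`! * m.+1`!) = (2 * m)`!.
Proof.
rewrite /catalan divnK //; apply/dvdnP; exists ('C(2 * m, m) - 'C(2 * m, m.+1)).
have h1 := @bin_fact (2 * m) m ltac:(lia).
have h2 := mul_bin_left (2 * m) m.
have e : 2 * m - m = m by lia.
rewrite e in h1 h2.
have -> : ('C(2 * m, m) - 'C(2 * m, m.+1)) * (m`! * m.+1`!) =
          (('C(2 * m, m) - 'C(2 * m, m.+1)) * m.+1) * (m`! * m`!).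
  by rewrite factS -!mulnA; congr (_ * _); rewrite mulnCA.
by rewrite mulnBl [X in _ - X]mulnC h2 -h1 mulnS [X in _ + X]mulnC addnK.
Qed.

(* Main.v *)
Require Import Defs.
From mathcomp Require Import all_boot.
From mathcomp Require Import boolp classical_sets functions cardinality.
From mathcomp Require Import zify finmap.
From Stdlib Require Import Relation_Operators.

(** Let [C_j] be the strongly extremal column, regarded as infinitely high
    since half-dominoes can be added to it forever.  Every other column looks
    to the right if its height is even and to the left if it is odd, and by the
    boundary conditions it sees a strictly higher column in that direction.
    Following these sight lines leads to [C_j]; let the label of a column be
    the number of parity changes met on the way before [C_j].  All operations
    preserve the labels: a column that reaches the height of the column it sees
    has the same parity, and then sees what that column saw.  Conversely,
    dominoes can be added until each column lies exactly its label below a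
    large common height on each side of [C_j], so [j] and the labels determine
    the class.

    The label sequences that occur on either side of [C_j], read away from it,
    are the words in which every letter [d > 0] has [d - 1] as its nearest
    smaller letter, on its right if [d] is odd and on its left if [d] is even.
    A nonempty word of this kind is cut at its first letter 0 into [b' 0 r],
    where [r] is such a word and [b'] is the mirror image of such a word with
    all letters increased by 1; hence the words of length [m] are counted by
    the Catalan number [catalan m]. *)

Set Implicit Arguments.
Unset Strict Implicit.
Unset Printing Implicit Defensive.

Local Open Scope nat_scope.
Local Open Scope classical_set_scope.
Local Open Scope card_scope.

(** * The Segner recurrence *)

Lemma catalanS m : m.+2 * catalan m.+1 = (4 * m + 2) * catalan m.
Proof.
have h1 := catalanK m; have h2 := catalanK m.+1.

have e : 2 * m.+1 = (2 * m).+2 by lia.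
rewrite e (factS (2 * m).+1) (factS (2 * m)) -h1 (factS m.+1) in h2.
have e1 := factS m.
apply/eqP; rewrite -(eqn_pmul2r (m := m.+1 * m`! * m.+1`!)); last first.
  by rewrite !muln_gt0 !fact_gt0.
apply/eqP; move: h2; rewrite e1.
set c := catalan m; set c' := catalan m.+1; set f := m`!. nia.
Qed.

Lemma catalan0 : catalan 0 = 1.
Proof. by []. Qed.

(** With [S] the convolution and [T] the same sum weighted by [i], the symmetry exchanging [i] and
    [m - i] gives [TS], and the ratio of consecutive Catalan numbers gives [rec]. Together they turn
    [S m] into [S m.+1] by the ratio of [catalanS]. *)
Lemma catalan_Segner m :
  catalan m.+1 = \sum_(i < m.+1) catalan i * catalan (m - i).
Proof.
pose S m := \sum_(i < m.+1) catalan i * catalan (m - i).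
pose T m := \sum_(i < m.+1) i * (catalan i * catalan (m - i)).
have TS k : 2 * T k = k * S k.
  have -> : 2 * T k = T k + T k by lia.
  rewrite {2}/T (reindex_inj rev_ord_inj) /= /T -big_split /= /S big_distrr /=.
  apply: eq_bigr => i _; rewrite !subSS subKn; last by rewrite -ltnS.
  by rewrite [catalan (k - i) * _]mulnC -mulnDl subnKC // -ltnS.
(* The right side has summands weighted by [i + 1]; its term at 0 is [catalan k.+1], and [catalanS]
   rewrites the others with weight [4 * i + 2]. *)
have rec k : (4 * T k + 2 * S k) + catalan k.+1 = T k.+1 + S k.+1.
  rewrite /T /S !big_distrr /= -big_split -big_split [RHS]big_ord_recl /=.
  rewrite subn0 catalan0 mul0n mul1n add0n addnC; congr (_ + _).
  apply: eq_bigr => i _; rewrite /bump /= add1n subSS.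
  have := catalanS i; nia.
elim: m => [|m IH]; first by rewrite big_ord1.
rewrite -/(S m.+1); rewrite -/(S m) in IH.
have := rec m; have := TS m; have := TS m.+1; have := catalanS m.+1.
rewrite -IH; nia.
Qed.

(** * Words *)

Definition between (x z y : nat) := (x < z < y) || (y < z < x).

Definition good (w : seq nat) := forall x, x < size w -> nth 0 w x = 0 \/
  exists y, [/\ y < size w, if odd (nth 0 w x) then x < y else y < x,
    nth 0 w x = (nth 0 w y).+1 &
    forall z, between x z y -> nth 0 w x <= nth 0 w z].

Definition graft (b r : seq nat) := rev (map succn b) ++ 0 :: r.

Lemma size_graft b r : size (graft b r) = (size b + size r).+1.
Proof. by rewrite size_cat size_rev size_map /= addnS. Qed.

Lemma nth_graft b r x : nth 0 (graft b r) x =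
  if x < size b then (nth 0 b ((size b).-1 - x)).+1
  else nth 0 (0 :: r) (x - size b).
Proof.
rewrite nth_cat size_rev size_map; case: ifP => // xb.
rewrite nth_rev size_map // (nth_map 0); last by lia.
by congr (nth _ _ _).+1; lia.
Qed.

(** The letters before the separating 0 are successors, so the first 0 stands at position [size b]
    and shows where to cut. *)
Lemma graft_inj b r b' r' : graft b r = graft b' r' -> b = b' /\ r = r'.
Proof.
have idx c s : index 0 (graft c s) = size c.
  rewrite index_cat mem_rev ifN; first by rewrite size_rev size_map addn0.
  by apply/mapP => -[].
move=> e; have es : size b = size b' by rewrite -(idx b r) e idx.
have sz : size (rev (map succn b)) = size (rev (map succn b')).
  by rewrite !size_rev !size_map.
move/eqP: e; rewrite /graft eqseq_cat // => /andP[/eqP e /eqP[->]]; split=> //.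
by apply: (inj_map succn_inj); rewrite -[LHS]revK e revK.
Qed.

(** Mirroring swaps the directions and adding 1 swaps the parities, so the rule for [b] survives;
    the letters 0 of [b] become 1 and find the separating 0 on their right. That 0 is smaller than
    every positive letter, so no search passes it. *)
Lemma good_graft b r : good (graft b r) <-> good b /\ good r.
Proof.
have E1 x : x < size b -> nth 0 (graft b r) ((size b).-1 - x) = (nth 0 b x).+1.
  by move=> xb; rewrite nth_graft ifT; [congr (nth _ _ _).+1|]; lia.
have E2 : nth 0 (graft b r) (size b) = 0 by rewrite nth_graft ltnn subnn.
have E3 x : nth 0 (graft b r) ((size b).+1 + x) = nth 0 r x.
  by rewrite nth_graft ifN ?addSn -?addnS ?addKn //; lia.
have sw := size_graft b r.
move: (graft b r) E1 E2 E3 sw => w E1 E2 E3 sw; split=> [gw|[gb gr]].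
  split=> x xs.
    have [|[y [ys dy ey zy]]] := gw ((size b).-1 - x) ltac:(lia).
      by rewrite E1.
    rewrite E1 // in dy ey zy.
    have [->|bx] := eqVneq (nth 0 b x) 0; [by left|right].
    have yb : y < size b.
      have [//|yb|yb] := ltngtP y (size b); last by move: ey; rewrite yb E2; lia.
      by have := zy (size b); rewrite E2 /between; lia.
    have {}ey : nth 0 b x = (nth 0 b ((size b).-1 - y)).+1.
      rewrite -E1; last by lia.
      have -> : (size b).-1 - ((size b).-1 - y) = y by lia.
      by case: ey.
    exists ((size b).-1 - y); split=> //; first by lia.
      move: dy; rewrite oddS; case: (odd (nth 0 b x)); rewrite /=; lia.
    move=> z; rewrite /between => zb.
    by have := zy ((size b).-1 - z); rewrite E1 /between; lia.
  have [|[y [ys dy ey zy]]] := gw ((size b).+1 + x) ltac:(lia).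
    by rewrite E3; left.
  rewrite !E3 in dy ey zy; right.
  (* A search ending at the separating 0 would start from a letter 1, which looks to the right, away
     from that 0. *)
  have by_ : size b < y.
    have [yb|//|yb] := ltngtP y (size b).
      by have := zy (size b); rewrite E2 ey /between; lia.
    by move: ey dy; rewrite yb E2 => -> /=; lia.
  exists (y - (size b).+1); split; first by lia.
  - by case: ifP dy; lia.
  - by rewrite ey -[in RHS]E3 subnKC.
  - by move=> z zb; have := zy ((size b).+1 + z); rewrite E3 /between in zb *; lia.
move=> X Xs; have [Xb|Xb|->] := ltngtP X (size b); last by left.
  right; have [x xb ->] : exists2 x, x < size b & X = (size b).-1 - x.
    by exists ((size b).-1 - X); lia.
  rewrite E1 //=; have [e0|[y [ys dy ey zy]]] := gb x xb.
    exists (size b); rewrite e0 /= E2; split=> //; [lia|lia|].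
    move=> z; rewrite /between => zb; have := E1 ((size b).-1 - z).
    have -> : (size b).-1 - ((size b).-1 - z) = z by lia.
    lia.
  exists ((size b).-1 - y); rewrite E1 //; split=> //; [by lia| |by lia|].
    by case: (odd _) dy => /=; lia.
  move=> z; rewrite /between => zb; have := E1 ((size b).-1 - z).
  have -> : (size b).-1 - ((size b).-1 - z) = z by lia.
  by move=> ->; [have := zy ((size b).-1 - z); rewrite /between|]; lia.
have [x xr ->] : exists2 x, x < size r & X = (size b).+1 + x.
  by exists (X - (size b).+1); lia.
rewrite E3; have [->|[y [ys dy ey zy]]] := gr x xr; [by left|right].
exists ((size b).+1 + y); rewrite E3; split=> //; first by lia.
  by case: (odd _) dy; lia.
move=> z; rewrite /between => zb; have := zy (z - (size b).+1).
by rewrite -(E3 (z - (size b).+1)) subnKC /between; lia.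
Qed.

(** Passing repeatedly to the nearest smaller letter ends at a 0, and the word is cut at its first
    0. *)
Lemma good_graftP w : good w -> w != [::] -> exists b r, w = graft b r.
Proof.
move=> gw w0.
have w_0 : 0 \in w.
  suff H d x : x < size w -> nth 0 w x = d -> 0 \in w.
    by apply: (H (nth 0 w 0) 0) => //; case: (w) w0.
  elim: d x => [|d IH] x xw e; first by rewrite -e mem_nth.
  have [e0|[y [yw _ ey _]]] := gw x xw; first by rewrite -e0 mem_nth.
  by apply: (IH y) => //; lia.
exists (rev (map predn (take (index 0 w) w))), (drop (index 0 w).+1 w).
rewrite /graft map_rev revK -map_comp map_id_in.
  rewrite -{2}(nth_index 0 w_0) -drop_nth ?index_mem // cat_take_drop //.
move=> d /= dw; rewrite prednK // lt0n; apply: contraL dw => /eqP ->.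
apply/negP => /(nthP 0)[i]; rewrite size_take index_mem w_0 => iw.
by rewrite nth_take // => e; have := before_find 0 iw; rewrite /= e eqxx.
Qed.

Lemma good_words m : exists L : seq (seq nat), [/\ uniq L, size L = catalan m &
  forall w, (w \in L) <-> size w = m /\ good w].
Proof.
(* The recurrence uses all shorter lengths, so the induction carries a table of lists for every
   length up to [m]. *)
suff [F HF] : exists F : nat -> seq (seq nat), forall k, k <= m ->
    [/\ uniq (F k), size (F k) = catalan k &
      forall w, (w \in F k) <-> size w = k /\ good w].
  by exists (F m); apply: HF.
elim: m => [|m [F HF]].
  exists (fun _ => [:: [::]]) => k; rewrite leqn0 => /eqP ->; split=> // w.
  rewrite inE; split=> [/eqP-> //|[/eqP]]; by rewrite size_eq0.
pose P k := [seq (b, r) | b <- F k, r <- F (m - k)].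
pose L := [seq graft p.1 p.2 | k <- iota 0 m.+1, p <- P k].
have PP k p : k <= m -> p \in P k ->
    [/\ size p.1 = k, good p.1, size p.2 = m - k & good p.2].
  move=> km /allpairsP[[b r] /= [bF rF ->]] /=.
  have [_ _ /(_ b) [Hb _]] := HF k km.
  have [_ _ /(_ r) [Hr _]] := HF (m - k) (leq_subr _ _).
  by have [] := Hb bF; have [] := Hr rF.
exists (fun k => if k <= m then F k else L) => k; rewrite leq_eqVlt ltnS.
move=> /orP[/eqP ->|km]; last by rewrite km; apply: HF.
rewrite ltnn; split.
- apply: allpairs_uniq_dep => [|k0|]; first exact: iota_uniq.
    rewrite mem_iota add0n ltnS /= => km; apply: allpairs_uniq.
    + by have [] := HF k0 km.
    + by have [] := HF (m - k0) (leq_subr _ _).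
    + by move=> [? ?] [? ?].
  move=> _ _ /allpairsPdep[x [p [xm pP ->]]] /allpairsPdep[x' [p' [xm' pP' ->]]] /=.
  rewrite !mem_iota !ltnS /= in xm xm'.
  have [s1 _ _ _] := PP _ _ xm pP; have [s1' _ _ _] := PP _ _ xm' pP'.
  move=> /graft_inj[e1 e2]; have xx : x = x' by rewrite -s1 -s1' e1.
  rewrite xx; congr (Tagged _ _).
  by case: p p' e1 e2 {pP pP' s1 s1'} => [? ?] [? ?] /= -> ->.
- rewrite size_allpairs_dep sumnE big_map catalan_Segner.
  rewrite -[iota 0 m.+1]/(index_iota 0 m.+1) big_mkord; apply: eq_bigr => i _.
  have im : i <= m by rewrite -ltnS.
  rewrite size_allpairs; have [_ -> _] := HF i im.
  by have [_ -> _] := HF (m - i) (leq_subr _ _).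
- move=> w; split=> [/allpairsPdep[x [p [xm pP ->]]]|[sw gw]].
    rewrite mem_iota ltnS /= in xm; have [s1 g1 s2 g2] := PP _ _ xm pP.
    by rewrite size_graft s1 s2 subnKC //; split=> //; apply/good_graft.
  have [|b [r ew]] := good_graftP gw; first by rewrite -size_eq0 sw.
  move: gw; rewrite ew => /good_graft[gb gr].
  move: sw; rewrite ew size_graft => -[sw].
  apply/allpairsPdep; exists (size b), (b, r).
  have bm : size b <= m by lia.
  rewrite mem_iota /= ltnS bm; split=> //; apply/allpairsP; exists (b, r) => /=.
  have [_ _ /(_ b) [_ Hb]] := HF (size b) bm.
  have [_ _ /(_ r) [_ Hr]] := HF (m - size b) (leq_subr _ _).
  by split=> //; [apply: Hb|apply: Hr; split=> //; by rewrite -sw addKn].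
Qed.

(** * Labels *)

(* [lia] interprets [odd] by a division; where only the truth values of the
   parities matter, hiding them is much faster. *)
Ltac blia :=
  repeat match goal with
  | |- context [odd ?x] => let b := fresh in set b := odd x in *; clearbody b
  | _ : context [odd ?x] |- _ =>
    let b := fresh in set b := odd x in *; clearbody b
  end; lia.

(** The conditions encode that [b] lies ahead of [a] in direction [o], where [true] is leftwards, as
    for odd heights in [sees]. *)
Lemma ahead_trans (o : bool) (a b c : nat) :
  (b != a) && (o == (b < a)) -> (c != b) && (o == (c < b)) ->
  (c != a) && (o == (c < a)).
Proof. by case: o; lia. Qed.

Lemma between_split (o : bool) (a b c z : nat) :
  (b != a) && (o == (b < a)) -> (c != b) && (o == (c < b)) ->
  between a z c -> [\/ z = b, between a z b | between b z c].
Proof.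
rewrite /between => ab bc z_ac; case: (ltngtP z b) => [zb|zb|->]; last by constructor.
  by case: o ab bc => ab bc; [constructor 3|constructor 2]; lia.
by case: o ab bc => ab bc; [constructor 2|constructor 3]; lia.
Qed.

(** Eliminates [ht], so that later checks compare only two columns at a time. *)
Lemma strongly_extremalP n (D : {ffun 'I_n -> nat}) (j : 'I_n) :
  strongly_extremal D j <-> forall i : 'I_n, i != j :> nat ->
    (D i < D j) || (D i == D j) && (odd (D j) == (j < i)).
Proof.
have leht i : D i <= ht D by apply: (leq_bigmax i).
split=> [/andP[/eqP hj]|H].
  rewrite -hj; case: ifP => [oj /forallP H|oj /forallP H] i ij;
    move: (H i) (leht i); rewrite -hj; lia.
have hj : D j = ht D.
  apply/eqP; rewrite eqn_leq leht /=; apply/bigmax_leqP => i _.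
  by have [/val_inj-> //|/H] := eqVneq (i : nat) j; lia.
rewrite /strongly_extremal hj eqxx -hj /=.
by case: ifP => oj; apply/forallP => i; have := H i; lia.
Qed.

Lemma strongly_extremal_uniq n (D : {ffun 'I_n -> nat}) (j j' : 'I_n) :
  strongly_extremal D j -> strongly_extremal D j' -> j = j'.
Proof.
move=> /strongly_extremalP H /strongly_extremalP H'; apply: val_inj => /=.
by have := H j'; have := H' j; lia.
Qed.

Lemma strongly_extremal_exists n (D : {ffun 'I_n.+1 -> nat}) :
  exists j, strongly_extremal D j.
Proof.
have [i0 hi0] := eq_bigmax D ltac:(by rewrite card_ord).
have leht i : D i <= ht D by apply: (leq_bigmax i).
have i0P : D i0 == ht D by rewrite /ht hi0.
case oD : (odd (ht D)).
  have [j jP jmin] := @arg_minnP _ i0 (fun i => D i == ht D) (fun i => i : nat) i0P.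
  exists j; apply/strongly_extremalP => i ij; rewrite (eqP jP) oD.
  by have := leht i; have := jmin i; lia.
have [j jP jmax] := @arg_maxnP _ i0 (fun i => D i == ht D) (fun i => i : nat) i0P.
exists j; apply/strongly_extremalP => i ij; rewrite (eqP jP) oD.
by have := leht i; have := jmax i; lia.
Qed.

(* [l] is the first column to the left (for [D i] odd) or to the right (for
   [D i] even) of [i] that is [j] or higher than [i]. *)
Definition sees n (j : 'I_n) (D : {ffun 'I_n -> nat}) (i l : 'I_n) : Prop :=
  [/\ (l != i :> nat) && (odd (D i) == (l < i)), (l == j :> nat) || (D i < D l) &
    forall m : 'I_n, between i m l -> (m != j :> nat) && (D m <= D i)].

Lemma seesI n (j : 'I_n) (D : {ffun 'I_n -> nat}) (i l : 'I_n) :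
  (l != i :> nat) && (odd (D i) == (l < i)) -> (l == j :> nat) || (D i < D l) ->
  exists l', sees j D i l'.
Proof.
move=> il Pl.
pose P (m : 'I_n) := [&& m != i :> nat, odd (D i) == (m < i) &
  (m == j :> nat) || (D i < D m)].
have Pl' : P l by rewrite /P andbA il.
(* By truncated subtraction, the minimised quantity is the distance from [i] to [m]. *)
have [l' Pl'' lmin] := arg_minnP (fun m : 'I_n => (m - i) + (i - m)) Pl'.
exists l'; move: Pl''; rewrite /P => Pl''; split; [lia|lia|].
by move=> m mb; have := lmin m; rewrite /P /between in mb *; lia.
Qed.

Lemma sees_fun n (j : 'I_n) (D : {ffun 'I_n -> nat}) (i l l' : 'I_n) :
  sees j D i l -> sees j D i l' -> l = l'.
Proof.
move=> [d b a] [d' b' a']; apply: val_inj => /=.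
by have := a l'; have := a' l; rewrite /between; lia.
Qed.

(** If an odd column sees nothing, the leftmost column of its height is left extremal, against the
    boundary conditions and the choice of [j]; the even case is the mirror image. Conversely, a
    column other than [j] that sees something is not extremal on the side to which it looks. *)
Lemma boundary_sees n (j : 'I_n) (D : {ffun 'I_n -> nat}) :
  strongly_extremal D j ->
  boundary D <-> forall i : 'I_n, i != j :> nat -> exists l, sees j D i l.
Proof.
move=> sj; have sjP := (strongly_extremalP D j).1 sj.
have jht : D j = ht D by case/andP: sj => /eqP.
split=> [/forallP B i ij|S].
  have [[l]|NE] := pselect (exists l : 'I_n,
      (l != i :> nat) && (odd (D i) == (l < i)) /\ (l == j :> nat) || (D i < D l)).
    by case; apply: seesI.
  have {}NE (l : 'I_n) : (l != i :> nat) -> odd (D i) = (l < i) ->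
      (l != j :> nat) && (D l <= D i).
    by move=> li o; apply: contra_notT NE => ?; exists l; lia.
  have ii : D i == D i by [].
  case oi : (odd (D i)).
    have [k /eqP kP kmin] := @arg_minnP _ i (fun k => D k == D i) (fun i => i : nat) ii.
    have ki := kmin i (eqxx _).
    have : left_extremal D k.
      by apply/forallP => l; have := NE l; have := kmin l; lia.
    move: (B k) => /andP[+ _] => /implyP/[apply]; rewrite kP oi -jht /=.
    by have := sjP k; have := NE j; lia.
  have [k /eqP kP kmax] := @arg_maxnP _ i (fun k => D k == D i) (fun i => i : nat) ii.
  have ki := kmax i (eqxx _).
  have : right_extremal D k.
    by apply/forallP => l; have := NE l; have := kmax l; lia.
  move: (B k) => /andP[_] => /implyP/[apply]; rewrite kP oi -jht /=.
  by have := sjP k; have := NE j; lia.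
apply/forallP => i; rewrite -jht.
have [/val_inj->|ij] := eqVneq (i : nat) j; first by rewrite eqxx !orbT !implybT.
have [l [d b _]] := S i ij; have h := sjP i ij.
have {}b : (l == j) || (D i < D l) by rewrite -val_eqE.
apply/andP; split; apply/implyP => /forallP/(_ l);
  by case/orP: b d => [/eqP->|]; lia.
Qed.

(** The labels are given by their recursion along sight lines; [d j] is left free, so labels are
    compared only away from [j]. *)
Definition labelling n (j : 'I_n) (D : {ffun 'I_n -> nat}) (d : 'I_n -> nat) :=
  forall i : 'I_n, i != j :> nat -> exists2 l, sees j D i l &
    d i = if l == j :> nat then 0 else d l + (odd (D i) != odd (D l)).

Lemma labelling_exists n (j : 'I_n) (D : {ffun 'I_n -> nat}) :
  (forall i : 'I_n, i != j :> nat -> exists l, sees j D i l) ->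
  exists d, labelling j D d.
Proof.
move=> S.
have [s sP] : {s : 'I_n -> 'I_n & forall i : 'I_n,
    i != j :> nat -> sees j D i (s i)}.
  apply: (@choice _ _ (fun i l : 'I_n => i != j :> nat -> sees j D i l)) => i.
  by have [_|/S[l Sl]] := eqVneq (i : nat) j; [exists j|exists l].
pose fix d N (i : 'I_n) {struct N} := if N is N'.+1 then
  if s i == j :> nat then 0 else d N' (s i) + (odd (D i) != odd (D (s i))) else 0.
have leht i : D i <= ht D by apply: (leq_bigmax i).
(* Heights increase strictly along a sight line before it reaches [j], so fuel exceeding
   [ht D - D i] is enough. *)
have dS N (i : 'I_n) : i != j :> nat -> ht D < N + D i -> d N i = d N.+1 i.
  elim: N i => [|N IH] i ij Ni; first by have := leht i; lia.
  rewrite [LHS]/= [RHS]/=; case: ifP => // sj; congr (_ + _).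
  have [_ +  _] := sP i ij; rewrite sj /= => b.
  by rewrite IH //=; lia.
exists (d (ht D).+1) => i ij; exists (s i); first exact: sP.
by rewrite dS //; lia.
Qed.

Lemma labelling_uniq n (j : 'I_n) (D : {ffun 'I_n -> nat}) d d' :
  labelling j D d -> labelling j D d' ->
  forall i : 'I_n, i != j :> nat -> d i = d' i.
Proof.
move=> H H' i; have leht k : D k <= ht D by apply: (leq_bigmax k).
have [N] := ubnP (ht D - D i); elim: N i => // N IH i Ni ij.
have [l Sl ->] := H i ij; have [l' Sl' ->] := H' i ij.
rewrite -(sees_fun Sl Sl'); case: ifP => // lj; congr (_ + _).
by have [_ + _] := Sl; have := leht l; rewrite lj => /= ? ?; apply: IH; lia.
Qed.

(** A sight line never crosses [j], so it stays on one side. Its last column looks towards [j] and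
    has label 0; earlier, label and height change parity together. *)
Lemma labelling_parity n (j : 'I_n) (D : {ffun 'I_n -> nat}) d :
  labelling j D d -> forall i : 'I_n, i != j :> nat ->
  odd (D i) = odd (d i) (+) (j < i).
Proof.
move=> H i; have leht k : D k <= ht D by apply: (leq_bigmax k).
have [N] := ubnP (ht D - D i); elim: N i => // N IH i Ni ij.
have [l Sl ->] := H i ij; case: ifP => lj.
  by have [] := Sl; lia.
have [] := Sl; rewrite /between lj => /= d1 d2 /(_ j) d3.
have -> : (j < i) = (j < l) by blia.
rewrite oddD oddb (IH l); [|by have := leht l; blia|by rewrite lj].
by case: (odd (D i)) (odd (d l)) (j < l) => [] [] [].
Qed.

(** Column [j] counts as infinitely high in [sees], so its actual height never enters. *)
Lemma labelling_half n (j : 'I_n) (D D' : {ffun 'I_n -> nat}) d :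
  (forall i : 'I_n, i != j :> nat -> D' i = D i) ->
  labelling j D d -> labelling j D' d.
Proof.
move=> e H i ij; have [l [d1 d2 d3] dl] := H i ij; exists l.
  split; rewrite e //; last by move=> m /d3 /andP[mj h]; rewrite mj e.
  by have [//|lj] := eqVneq (l : nat) j; rewrite e //; move: d2; rewrite (negPf lj).
by rewrite dl; case: ifP => // lj; rewrite !e ?lj.
Qed.

(** Parities are kept, so only sight lines can change. If [i0] reaches the height of the column it
    saw, it now sees what that column sees. A column that looked over [i0] and is now blocked has
    the old height of [i0], saw the same column as [i0] did, and now sees [i0]. Neither change adds
    or removes a parity change. *)
Lemma labelling_domino n (j i0 : 'I_n) (D D' : {ffun 'I_n -> nat}) d :
  (forall k, D' k = D k + 2 * (k == i0 :> nat)) -> i0 != j :> nat ->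
  (forall l, sees j D i0 l -> D i0 + 2 <= D l) ->
  labelling j D d -> labelling j D' d.
Proof.
move=> e i0j up H i ij.
have oe k : odd (D' k) = odd (D k) by rewrite e; lia.
have [l0 S0 dl0] := H i0 i0j; have u0 := up l0 S0.
have [l S dl] := H i ij.
have [/val_inj ei|ii0] := eqVneq (i : nat) i0.
  subst i; rewrite -(sees_fun S S0) in u0.
  have [d1 d2 d3] := S.
  have [lj|lj] := boolP ((l == j :> nat) || (D i0 + 2 < D l)).
    exists l; last by rewrite dl !oe.
    split; rewrite ?oe ?e //; [by blia|].
    by move=> m mb; have := d3 m mb; rewrite !e; rewrite /between in mb; blia.
  have jl : l != j :> nat by blia.
  have ol : odd (D l) = odd (D i0) by clear -lj u0; lia.
  have [l1 [d1' d2' d3'] dl1] := H l jl.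
  rewrite ol in d1'; exists l1.
    split; rewrite ?oe ?e ?eqxx; [exact: ahead_trans d1 d1'|by clear -d2' lj u0; lia|].
    move=> m mb.
    have mi : m != i0 :> nat by clear -mb; rewrite /between in mb; lia.
    rewrite !e ?eqxx (negPf mi).
    have [/val_inj->|/d3|/d3'] := between_split d1 d1' mb; clear -u0 lj jl; lia.
  rewrite dl (negPf jl) dl1 !oe ol eqxx addn0 //.
have [d1 d2 d3] := S; have [d1' d2' d3'] := S0.
have [nb|] := boolP (between i i0 l && (D i < D i0 + 2)); last first.
  move=> nb; exists l; last by rewrite dl !oe.
  split; rewrite ?oe ?e; [exact: d1|by clear -d2 ii0; lia|].
  move=> m mb; have := d3 m mb; rewrite !e.
  by have [/val_inj e'|] := eqVneq (m : nat) i0; [subst m|]; clear -nb mb ii0; lia.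
(* Otherwise [D i = D i0 + 1] and [i0] looks back towards [i]. The column it sees is higher than
   [i]: before [i] it would have blocked the view of [i], and beyond [i] the view of [i0] would have
   stopped at [i]. *)
have Di : D i = D i0.
  have := d3 i0; have := d3 l0; have := d3' i.
  have [/val_inj e'|] := eqVneq (l0 : nat) i; first subst l0.
    by clear -u0 nb d1' d3; rewrite /between in nb *; have := d3 i0; blia.
  by rewrite /between in nb *; blia.
have S0l : sees j D i0 l.
  split; rewrite -?Di; [by clear -nb d1 Di; rewrite /between in nb; blia|by []|].
  move=> m mb; apply: d3; clear -mb nb; by rewrite /between in nb mb *; lia.
exists i0; last by rewrite dl dl0 (negPf i0j) (sees_fun S0 S0l) !oe Di eqxx addn0.
split; rewrite ?oe ?e ?eqxx;
  [by clear -nb d1; rewrite /between in nb; blia|by clear -Di ii0; lia|].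
move=> m mb; rewrite !e (negPf ii0).
have mi : m != i0 :> nat by clear -mb; rewrite /between in mb; lia.
rewrite (negPf mi); have := d3 m; clear -mb nb.
by rewrite /between in nb mb *; lia.
Qed.

(** The order of two heights changes only when [k - 1] and [k + 1] become equal; these have the same
    parity, so the lower column may take over the sight line of the higher one. *)
Lemma labelling_row n (j : 'I_n) k (D D' : {ffun 'I_n -> nat}) d :
  (forall i, D' i = D i - 2 * (k < D i)) -> 0 < k -> (forall i, D i <> k) ->
  labelling j D d -> labelling j D' d.
Proof.
move=> e k0 nk H i ij.
have oe m : odd (D' m) = odd (D m) by rewrite e; lia.
have [l S dl] := H i ij; have [d1 d2 d3] := S.
have [lj|lj] := boolP ((l == j :> nat) || (D' i < D' l)).
  exists l; last by rewrite dl !oe.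
  split; rewrite ?oe //.
  by move=> m /d3; have := nk m; rewrite !e; clear -k0; lia.
have jl : l != j :> nat by lia.
have gap : D i = k.-1 /\ D l = k.+1.
  by move: lj d2; rewrite !e; have := nk i; have := nk l; clear -k0; lia.
have [l1 [d1' d2' d3'] dl1] := H l jl.
have ol : odd (D l) = odd (D i) by clear -gap k0; lia.
exists l1; last by rewrite dl (negPf jl) dl1 !oe ol eqxx addn0 //.
rewrite ol in d1'; have nkl1 := nk l1.
split; rewrite ?oe ?e; [exact: ahead_trans d1 d1'|by clear -d2' gap k0; lia|].
move=> m mb; have := nk m; rewrite !e.
have [/val_inj->|/d3|/d3'] := between_split d1 d1' mb; clear -gap k0 jl; lia.
Qed.

(** * Invariance and completeness of the labels *)

Definition marked n (j : 'I_n) (d : 'I_n -> nat) (D : {ffun 'I_n -> nat}) :=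
  strongly_extremal D j /\ labelling j D d.

Lemma marked_boundary n (j : 'I_n) d (D : {ffun 'I_n -> nat}) :
  marked j d D -> boundary D.
Proof.
move=> [sj H]; apply/(boundary_sees sj) => i ij.
by have [l Sl _] := H i ij; exists l.
Qed.

Lemma marked_exists n (D : diagram n.+1) : exists j d, marked j d D.
Proof.
have [j sj] := strongly_extremal_exists D; exists j.
have [d H] := labelling_exists ((boundary_sees sj).1 (diagram_boundary D)).
by exists d.
Qed.

Lemma marked_uniq n (j j' : 'I_n) d d' (D : {ffun 'I_n -> nat}) :
  marked j d D -> marked j' d' D ->
  j = j' /\ forall i : 'I_n, i != j :> nat -> d i = d' i.
Proof.
move=> [sj H] [sj' H']; have e := strongly_extremal_uniq sj sj'.
by subst j'; split=> // i; apply: labelling_uniq H H' i.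
Qed.

Lemma marked_ext n (j : 'I_n) d d' (D : {ffun 'I_n -> nat}) :
  (forall i : 'I_n, i != j :> nat -> d i = d' i) -> marked j d D -> marked j d' D.
Proof.
move=> e [sj H]; split=> // i ij; have [l Sl dl] := H i ij; exists l => //.
by rewrite -e // dl; case: ifP => // lj; rewrite e ?lj.
Qed.

Lemma domino_addableP n (D : {ffun 'I_n -> nat}) (i : 'I_n) :
  domino_addable D i <-> exists l : 'I_n,
    [/\ (l != i :> nat) && (odd (D i) == (l < i)), D i + 2 <= D l &
      forall m : 'I_n, between i m l -> D m <= D i].
Proof.
split.
  by case=> -[oi [l [il Dl H]]]; exists l; split=> // [|m mb];
    [move: il; blia|apply: H; rewrite /between in mb; lia|
     move: il; blia|apply: H; rewrite /between in mb; lia].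
move=> [l [il Dl H]]; case oi : (odd (D i)) il => il; [right|left];
  by split; rewrite ?oi //; exists l; split=> //;
  [lia|move=> m mb; apply: H; rewrite /between; lia].
Qed.

Lemma marked_domino n (j : 'I_n) d (D D' : {ffun 'I_n -> nat}) :
  marked j d D -> domino_adjunction D D' -> marked j d D'.
Proof.
move=> [sj H] [i [/domino_addableP[l [il Dl Hl]] eD]].
have sjP := (strongly_extremalP D j).1 sj.
have e k : D' k = D k + 2 * (k == i :> nat).
  by rewrite eD ffunE -val_eqE /=; case: ifP; rewrite ?addn0.
have Dj k : D k <= D j.
  by have [/val_inj-> //|/sjP] := eqVneq (k : nat) j; clear; blia.
have ij : i != j :> nat.
  by apply/eqP => /val_inj ij; have := Dj l; rewrite -ij; clear -Dl; lia.
have ji : j != i :> nat by rewrite eq_sym.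
split; last first.
  apply: labelling_domino e ij _ H => l' Sl'.
  rewrite (sees_fun (l := l') (l' := l) Sl') //.
  split=> //; first by rewrite orbC; clear -Dl; lia.
  move=> m mb; rewrite Hl // andbT; apply/eqP => /val_inj mj.
  by have := Hl m mb; have := Dj l; rewrite mj; clear -Dl; lia.
apply/strongly_extremalP => k kj; rewrite !e (negPf ji) muln0 addn0.
have [/val_inj ki|ki] := eqVneq (k : nat) i; last by rewrite muln0 addn0 sjP.
subst k; rewrite muln1.
(* In case of a tie, [l] is as high as [j], so it is [j] or on the side where ties are allowed; [i]
   lies beyond [l] on that side. *)
have [lt|eq] : D i + 2 < D j \/ D i + 2 = D j by have := Dj l; clear -Dl; lia.
  by rewrite lt.
rewrite -eq ltnn eqxx /= oddD addbF.
have [/val_inj lj|/sjP h] := eqVneq (l : nat) j.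
  by subst l; case: (odd (D i)) il; clear -ij; lia.
have := h; rewrite -eq oddD addbF; case: (odd (D i)) il; have := Dj l; clear -eq Dl ij; lia.
Qed.

Lemma marked_half n (j : 'I_n) d (D D' : {ffun 'I_n -> nat}) :
  marked j d D -> half_domino_adjunction D D' -> marked j d D'.
Proof.
move=> [sj H] [i [si eD]]; have e := strongly_extremal_uniq si sj; subst i.
have e (k : 'I_n) : k != j :> nat -> D' k = D k.
  by move=> kj; rewrite eD ffunE -val_eqE (negPf kj).
split; last exact: labelling_half e H.
apply/strongly_extremalP => k kj; rewrite e // eD ffunE eqxx.
by have := (strongly_extremalP D j).1 sj k kj; clear; lia.
Qed.

Lemma marked_row n (j : 'I_n) d (D D' : {ffun 'I_n -> nat}) :
  marked j d D -> row_cancellation D D' -> marked j d D'.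
Proof.
move=> [sj H] [k [k0 nk eD]].
have e i : D' i = D i - 2 * (k < D i).
  by rewrite eD ffunE addn1; case: ifP; rewrite ?subn0.
have sjP := (strongly_extremalP D j).1 sj.
split; last exact: labelling_row e k0 nk H.
apply/strongly_extremalP => i ij; have si := sjP i ij.
have oe m : odd (D' m) = odd (D m) by rewrite e; clear -k0; lia.
have [h|h] := boolP ((D i == D j) || (D' i < D' j)).
  rewrite oe; case/orP: h => [h|-> //]; move: si.
  by rewrite !e (eqP h) !ltnn !eqxx.
have gap : D i = k.-1 /\ D j = k.+1.
  have := nk i; have := nk j; move: h si; rewrite !e; clear -k0; case: (odd _ == _); lia.
have ee : D' i = D' j by rewrite !e; clear -gap k0; lia.
rewrite ee ltnn eqxx /= oe.
have oij : odd (D j) = odd (D i) by clear -gap k0; lia.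
rewrite oij in sjP *.
have [l [il Pl _] _] := H i ij.
(* Heights [k] being absent, a column [l] other than [j] seen by [i] has the height of [j]; it lies
   on the side where ties are allowed, and so does [i]. *)
have [/val_inj lj|lj] := eqVneq (l : nat) j.
  by subst l; clear -il; case/andP: il.
have := sjP l lj; have nkl := nk l; move: il Pl; rewrite (negPf lj) /=.
clear -gap nkl ij k0; case: (odd (D i)); lia.
Qed.

(** Forward preservation suffices: the source of a step has some marking, and uniqueness at its end
    identifies it with the given one. *)
Lemma marked_equiv n (D D' : diagram n.+1) j d :
  diagram_equiv D D' -> marked j d D <-> marked j d D'.
Proof.
elim=> {D D'} [D D' st|//|D D' _|D D1 D2 _ IH1 _ IH2]; [|by tauto|by tauto].
have fwd j0 d0 : marked j0 d0 D -> marked j0 d0 D'.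
  by move=> H; case: st; [apply: marked_domino|apply: marked_half|apply: marked_row].
split=> [|H]; first exact: fwd.
have [j0 [d0 H0]] := marked_exists D.
have [ej ed] := marked_uniq (fwd _ _ H0) H; subst j0.
exact: marked_ext ed H0.
Qed.

(** A normal form. The base heights [2 * K] on the left and [2 * K + 1] on the right make columns of
    label 0 look towards [j], which overtops them all. *)
Definition target n (j : 'I_n) (d : 'I_n -> nat) (K : nat) : {ffun 'I_n -> nat} :=
  [ffun i : 'I_n => if i == j :> nat then 2 * K + 2 else 2 * K + (j < i) - d i].

(* Raising at each stage a highest column among those still below their target
   is always allowed: the column it sees already has its final height. *)
Lemma equiv_target n (j : 'I_n) d K (D : diagram n) :
  marked j d D -> (forall i, D i <= target j d K i) ->
  (forall i : 'I_n, i != j :> nat -> d i <= 2 * K) ->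
  exists2 T : diagram n, heights T = target j d K & diagram_equiv D T.
Proof.
move=> M le dK.
have [N] := ubnP (\sum_i target j d K i - \sum_i D i).
elim: N D M le => // N IH D M le NK.
have sumE (D' : {ffun 'I_n -> nat}) (i : 'I_n) c :
    (forall k, D' k = D k + c * (k == i :> nat)) -> \sum_k D' k = \sum_k D k + c.
  move=> e; rewrite (eq_bigr _ (fun k _ => e k)) big_split /=; congr (_ + _).
  rewrite -big_distrr /= (bigD1 i) //= eqxx big1 ?addn0 ?muln1 // => k.
  by rewrite -val_eqE /= => /negPf ->.
have next (D' : {ffun 'I_n -> nat}) (i : 'I_n) c :
    (forall k, D' k = D k + c * (k == i :> nat)) -> 0 < c ->
    D i + c <= target j d K i -> marked j d D' ->
    [\/ domino_adjunction D D', half_domino_adjunction D D' | row_cancellation D D'] ->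
    exists2 T : diagram n, heights T = target j d K & diagram_equiv D T.
  move=> e c0 lei M' st.
  have le' k : D' k <= target j d K k.
    rewrite e; have [/val_inj->|_] := eqVneq (k : nat) i; first by rewrite muln1.
    by rewrite muln0 addn0.
  have [//|T eT eq] := IH (Diagram (marked_boundary M')) M' le'.
    have : \sum_k D' k <= \sum_k target j d K k by apply: leq_sum.
    rewrite /= (sumE _ _ _ e); clear -NK c0; move: NK.
    by move: (\sum_k target j d K k) (\sum_k D k) => a b; lia.
  by exists T => //; apply: rst_trans eq; apply: rst_step; exact: st.
have [sj H] := M; have par := labelling_parity H.
have [Dj|Dj] := ltnP (D j) (target j d K j).
  pose D' := [ffun k => if k == j then D k + 1 else D k].
  have hd : half_domino_adjunction D D' by exists j.
  apply: (next D' j 1) => //; last by constructor.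
  - by move=> k; rewrite ffunE -val_eqE /=; case: ifP; rewrite ?addn0.
  - by rewrite addn1.
  - exact: marked_half M hd.
have [eDT|] := boolP [forall i, D i == target j d K i].
  exists D; last exact: rst_refl.
  by apply/ffunP => i; apply/eqP; move/forallP: eDT.
rewrite negb_forall => /existsP[i1 lt1].
pose P i := D i != target j d K i.
have [i Pi imax] := @arg_maxnP _ i1 P D lt1.
have ij : i != j :> nat.
  apply: contraNneq Pi => /val_inj ->; rewrite eqn_leq Dj andbT; exact: le.
have [l Sl dl] := H i ij; have [il Dl Hl] := Sl.
have Ti : target j d K i = 2 * K + (j < i) - d i by rewrite ffunE (negPf ij).
(* Height and target have the same parity by [labelling_parity], so a column below its target misses
   at least a whole domino. *)
have up2 : D i + 2 <= target j d K i.
  have := par i ij; have := le i; have := Pi; have := dK i ij; rewrite /P Ti.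
  clear; case: (j < i) => /=; lia.
have upl : D i + 2 <= D l.
  have [/val_inj lj|lj] := eqVneq (l : nat) j.
    subst l; move: Dj; rewrite {1}ffunE eqxx; rewrite Ti in up2.
    by clear -up2; case: (j < i) up2 => /=; lia.
  have {}Dl : D i < D l by move: Dl; rewrite (negPf lj).
  have -> : D l = target j d K l.
    by apply/eqP; apply: contraTT Dl => Pl; rewrite -leqNgt; exact: imax.
  apply: leq_trans up2 _; rewrite Ti ffunE (negPf lj) dl (negPf lj).
  have -> : (j < l) = (j < i).
    have := Hl j; rewrite /between eqxx /=; move: il; clear -ij lj.
    by case: (odd _); lia.
  by clear; lia.
pose D' := [ffun k => if k == i then D k + 2 else D k].
have dd : domino_adjunction D D'.
  exists i; split=> //; apply/domino_addableP; exists l; split=> // m mb.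
  by have /andP[] := Hl m mb.
apply: (next D' i 2) => //; last by constructor.
- by move=> k; rewrite ffunE -val_eqE /=; case: ifP; rewrite ?addn0.
- exact: marked_domino M dd.
Qed.

(** * Labels as pairs of words *)

Lemma target_neq n (j : 'I_n) d K (i : 'I_n) : i != j :> nat ->
  target j d K i = 2 * K + (j < i) - d i.
Proof. by rewrite ffunE => /negPf->. Qed.

Lemma odd_target n (j : 'I_n) d K (i : 'I_n) : i != j :> nat ->
  d i <= 2 * K -> odd (target j d K i) = odd (d i) (+) (j < i).
Proof. by move=> ij dK; rewrite target_neq //; case: (j < i); lia. Qed.

Lemma strongly_extremal_target n (j : 'I_n) d K :
  strongly_extremal (target j d K) j.
Proof.
apply/strongly_extremalP => i ij; rewrite target_neq // ffunE eqxx.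
by case: (j < i); lia.
Qed.

(** Even labels look towards [j] and odd ones away from it: the rule of [good] for words read away
    from [j]. *)
Definition admissible n (j : 'I_n) (d : 'I_n -> nat) :=
  forall i : 'I_n, i != j :> nat -> d i = 0 \/ exists l : 'I_n,
    [/\ l != j :> nat, (l != i :> nat) && (odd (d i) (+) (j < i) == (l < i)),
      d i = (d l).+1 &
      forall m : 'I_n, between i m l -> (m != j :> nat) && (d i <= d m)].

(** On each side of [j] the target heights are a constant minus the labels, so the first higher
    column is the nearest smaller label. One sight step lowers a label by at most 1, hence here by
    exactly 1. *)
Lemma labelling_targetP n (j : 'I_n) d K :
  (forall i : 'I_n, i != j :> nat -> d i <= 2 * K) ->
  labelling j (target j d K) d <-> admissible j d.
Proof.
move=> dK; split=> H i ij; have ti := target_neq d K ij;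
  have oi := odd_target ij (dK i ij).
  have [l [il Dl Hl] dl] := H i ij; rewrite oi in il.
  have [lj|lj] := eqVneq (l : nat) j; [left|right; exists l].
    by rewrite dl lj eqxx.
  have sl : (j < l) = (j < i).
    have := Hl j; rewrite /between eqxx /=; move: il; clear -ij lj.
    by case: (_ (+) _); lia.
  have tl := target_neq d K lj; have ol := odd_target lj (dK l lj).
  have di := dK i ij; have dl' := dK l lj.
  split=> //; first last.
  - move=> m mb; have := Hl m mb; have [//|mj /= Dm] := eqVneq (m : nat) j.
    have sm : (j < m) = (j < i).
      have := Hl j; rewrite /between eqxx /=; move: mb; rewrite /between; clear -ij lj sl mj.
      by lia.
    move: Dm; rewrite ti target_neq // sm; have := dK m mj; clear -di.
    by case: (j < i); lia.
  - move: Dl dl; rewrite (negPf lj) /= oi ol ti tl sl; clear -di dl'.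
    by case: (j < i); case: (_ != _); lia.
have [d0|[l [lj il dl Hl]]] := H i ij.
  exists j; last by rewrite eqxx d0.
  split.
  - by rewrite oi d0; clear -ij; lia.
  - by rewrite eqxx.
  - move=> m mb; have mj : m != j :> nat by clear -mb; rewrite /between in mb; lia.
    rewrite mj target_neq // ti d0; clear -mb mj; rewrite /between in mb.
    by lia.
exists l; last first.
  rewrite (negPf lj) oi (odd_target lj (dK l lj)) dl /=.
  have -> : (j < l) = (j < i).
    have := Hl j; rewrite /between eqxx /=; move: il; clear -ij lj.
    by case: (_ (+) _); lia.
  by case: (odd (d l)); case: (j < i); rewrite addn1.
have sl : (j < l) = (j < i).
  have := Hl j; rewrite /between eqxx /=; move: il; clear -ij lj.
  by case: (_ (+) _); lia.
have di := dK i ij.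
split.
- by rewrite oi.
- rewrite ti target_neq // sl (negPf lj) /=; clear -dl di.
  by case: (j < i); lia.
- move=> m mb; have /andP[mj dm] := Hl m mb; rewrite mj /= target_neq // ti.
  have -> : (j < m) = (j < i).
    have := Hl j; rewrite /between eqxx /=; move: mb; rewrite /between; clear -ij lj sl mj.
    by lia.
  by clear -dm; lia.
Qed.

(* Both words are read starting next to column [j]. *)
Definition label_of n (j : 'I_n) (p : seq nat * seq nat) (i : 'I_n) :=
  if i < j then nth 0 p.1 (j.-1 - i) else nth 0 p.2 (i - j.+1).

Lemma label_left t (j : 'I_t.+1) p x : x < j ->
  exists i : 'I_t.+1, [/\ i < j, i = j.-1 - x :> nat & label_of j p i = nth 0 p.1 x].
Proof.
move=> xj; have it : j.-1 - x < t.+1 by have := ltn_ord j; lia.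
exists (Ordinal it); split=> //=; first by lia.
by rewrite /label_of /= ifT; [congr (nth _ _ _)|]; lia.
Qed.

Lemma label_right t (j : 'I_t.+1) p x : x < t - j ->
  exists i : 'I_t.+1, [/\ j < i, i = j.+1 + x :> nat & label_of j p i = nth 0 p.2 x].
Proof.
move=> xj; have it : j.+1 + x < t.+1 by lia.
exists (Ordinal it); split=> //=; first by lia.
by rewrite /label_of /= ifN; [congr (nth _ _ _)|]; lia.
Qed.

Lemma admissible_label t (j : 'I_t.+1) p :
  size p.1 = j -> size p.2 = t - j ->
  admissible j (label_of j p) <-> good p.1 /\ good p.2.
Proof.
move=> s1 s2; have jt := ltn_ord j; split=> [H|[g1 g2] i ij].
  split=> x xs.
    rewrite s1 in xs; have [i [ij ei di]] := label_left p xs.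
    have [d0|[l [lj il dl Hl]]] := H i ltac:(lia); first by left; rewrite -di.
    have lj' : l < j.
      have := Hl j; rewrite /between eqxx /=; move: il; clear -ij lj.
      by case: (_ (+) _); lia.
    right; exists (j.-1 - l); rewrite s1.
    have el : label_of j p l = nth 0 p.1 (j.-1 - l) by rewrite /label_of lj'.
    rewrite -di -el; split=> //; first by clear -lj'; lia.
      by move: il; case: (odd _); clear -ij ei xs lj'; lia.
    move=> z zb; have zj : z < j by clear -zb xs lj'; rewrite /between in zb; lia.
    have [m [mj em <-]] := label_left p zj.
    suff /Hl/andP[] : between i m l by [].
    rewrite /between in zb *; by clear -zb em ei xs lj' ij zj; lia.
  rewrite s2 in xs; have [i [ij ei di]] := label_right p xs.
  have [d0|[l [lj il dl Hl]]] := H i ltac:(lia); first by left; rewrite -di.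
  have lj' : j < l.
    have := Hl j; rewrite /between eqxx /=; move: il; clear -ij lj.
    by case: (_ (+) _); lia.
  right; exists (l - j.+1); rewrite s2.
  have el : label_of j p l = nth 0 p.2 (l - j.+1) by rewrite /label_of ltnNge (ltnW lj').
  rewrite -di -el; split=> //.
  - by have := ltn_ord l; clear -lj'; lia.
  - by move: il; case: (odd _); clear -ij ei xs lj'; lia.
  - move=> z zb; have zj : z < t - j.
      by have := ltn_ord l; clear -zb xs lj'; rewrite /between in zb; lia.
    have [m [mj em <-]] := label_right p zj.
    suff /Hl/andP[] : between i m l by [].
    rewrite /between in zb *; by clear -zb em ei xs lj' ij zj; lia.
have [lij|lij] := ltnP i j.
  have ei : label_of j p i = nth 0 p.1 (j.-1 - i) by rewrite /label_of lij.
  have [d0|[y [ys dy ey Hy]]] := g1 (j.-1 - i) ltac:(lia); first by left; rewrite ei.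
  rewrite -ei in dy ey Hy; rewrite s1 in ys; have [l [lj el dl]] := label_left p ys.
  right; exists l; rewrite dl; split=> //; first by clear -lj; lia.
    by case: (odd _) dy; clear -lij el ys; lia.
  move=> m mb; have mj : m < j by clear -mb lij lj; rewrite /between in mb; lia.
  apply/andP; split; first by clear -mj; lia.
  rewrite {2}/label_of mj; apply: Hy.
  by clear -mb mj lij ys el; rewrite /between in mb *; lia.
have {}lij : j < i by lia.
have ei : label_of j p i = nth 0 p.2 (i - j.+1) by rewrite /label_of ltnNge (ltnW lij).
have it := ltn_ord i.
have [d0|[y [ys dy ey Hy]]] := g2 (i - j.+1) ltac:(lia); first by left; rewrite ei.
rewrite -ei in dy ey Hy; rewrite s2 in ys; have [l [lj el dl]] := label_right p ys.
right; exists l; rewrite dl; split=> //; first by clear -lj; lia.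
  by case: (odd _) dy; clear -lij el ys; lia.
move=> m mb; have mj : j < m by clear -mb lij lj; rewrite /between in mb; lia.
apply/andP; split; first by clear -mj; lia.
rewrite {2}/label_of ltnNge (ltnW mj); apply: Hy.
by clear -mb mj lij ys el; rewrite /between in mb *; lia.
Qed.

Lemma label_of_inj t (j : 'I_t.+1) p p' :
  size p.1 = j -> size p.2 = t - j -> size p'.1 = j -> size p'.2 = t - j ->
  (forall i : 'I_t.+1, i != j :> nat -> label_of j p i = label_of j p' i) -> p = p'.
Proof.
move=> s1 s2 s1' s2' e; rewrite [p]surjective_pairing [p']surjective_pairing.
congr pair; apply: (@eq_from_nth _ 0); rewrite ?s1 ?s1' ?s2 ?s2' // => x xs.
  have [i [ij ei <-]] := label_left p xs; have [i' [_ ei' <-]] := label_left p' xs.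
  by rewrite (_ : i' = i) ?e //; [lia|apply: val_inj; rewrite /= ei ei'].
have [i [ij ei <-]] := label_right p xs; have [i' [_ ei' <-]] := label_right p' xs.
by rewrite (_ : i' = i) ?e //; [lia|apply: val_inj; rewrite /= ei ei'].
Qed.

Lemma label_of_surj t (j : 'I_t.+1) (d : 'I_t.+1 -> nat) : exists p,
  [/\ size p.1 = j, size p.2 = t - j &
    forall i : 'I_t.+1, i != j :> nat -> label_of j p i = d i].
Proof.
exists (mkseq (fun x => d (inord (j.-1 - x))) j,
        mkseq (fun x => d (inord (j.+1 + x))) (t - j)).
rewrite /= !size_mkseq; split=> // i ij; have it := ltn_ord i.
rewrite /label_of /=; case: ltnP => lij; rewrite nth_mkseq; try by lia.
  by congr d; apply: val_inj; rewrite /= inordK; lia.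
by congr d; apply: val_inj; rewrite /= inordK; lia.
Qed.

(** * Counting the classes *)

Lemma marked_target_exists n (j : 'I_n) d : admissible j d ->
  exists D : diagram n, marked j d D.
Proof.
move=> ad; pose K := \max_(i < n) d i.
have M : marked j d (target j d K).
  split; first exact: strongly_extremal_target.
  apply/labelling_targetP => // i _; apply: leq_trans (leq_pmull _ _) => //.
  exact: (leq_bigmax i).
by exists (Diagram (marked_boundary M)).
Qed.

(** Every large enough [K] works, so two diagrams with the same marking can be raised to a common
    target. *)
Lemma marked_reach n (j : 'I_n) d (D : diagram n) K :
  marked j d D -> \max_(i < n) D i + \max_(i < n) d i <= K ->
  exists2 T : diagram n, heights T = target j d K & diagram_equiv D T.
Proof.
move=> M le; have leD i : D i <= \max_(i < n) D i by apply: (leq_bigmax i).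
have led i : d i <= \max_(i < n) d i by apply: (leq_bigmax i).
apply: (equiv_target M) => i; last by have := led i; lia.
have := leD i; have := led i; rewrite ffunE; case: ifP => _; lia.
Qed.

Lemma marked_admissible n (j : 'I_n.+1) d (D : diagram n.+1) :
  marked j d D -> admissible j d.
Proof.
move=> M; have [T eT eq] := marked_reach M (leqnn _).
have := (marked_equiv j d eq).1 M => -[_]; rewrite eT => /labelling_targetP; apply=> i _.
by have : d i <= \max_(i < n.+1) d i by [apply: (leq_bigmax i)]; lia.
Qed.

Lemma diagram_classE n (j : 'I_n.+1) d (D : diagram n.+1) :
  marked j d D -> diagram_class D = [set D' : diagram n.+1 | marked j d D'].
Proof.
move=> M; apply/seteqP; split=> D' /=; first by move=> eq; apply/(marked_equiv j d eq).
move=> M'; pose K := maxn (\max_i D i) (\max_i D' i) + \max_i d i.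
have [|T eT eq] := @marked_reach _ _ _ _ K M; first by rewrite leq_add2r leq_maxl.
have [|T' eT' eq'] := @marked_reach _ _ _ _ K M'; first by rewrite leq_add2r leq_maxr.
have e : T = T' by apply: val_inj; rewrite /= eT eT'.
by apply: rst_trans eq _; apply: rst_sym; rewrite e.
Qed.

Lemma card_image_seq (T : choiceType) U (s : seq T) (f : T -> U) :
  uniq s -> {in s &, injective f} -> f @` [set` s] #= `I_(size s).
Proof.
move=> us fi; apply: (@card_eq_trans _ _ _ _ [set` s]).

  by apply: inj_card_eq => x y /set_mem xs /set_mem ys; apply: fi.
have -> : [set` s] = [set` [fset x in s]%fset].
  by apply/seteqP; split=> x /=; rewrite inE.
by apply/card_eq_fsetP; rewrite card_fseq undup_id.
Qed.

(* [j : 'I_t.+1] is the index of a column shifted by 1, i.e. it stands for the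
   index j + 1 with 1 <= j + 1 <= t + 1. *)
Theorem theorem4p1 (t : nat) :
  (Hset t.+1 #= `I_(catalan t.+1)) /\
  (forall j : 'I_t.+1, Hset_at j #= `I_(catalan j * catalan (t - j))).
Proof.
have [W HW] := choice good_words.
pose L (j : 'I_t.+1) := [seq (wl, wr) | wl <- W j, wr <- W (t - j)].
have uL j : uniq (L j).
  have [u _ _] := HW j; have [u' _ _] := HW (t - j).
  by apply: allpairs_uniq => // -[? ?] [? ?].
have sL j : size (L j) = catalan j * catalan (t - j).
  by rewrite size_allpairs; have [_ -> _] := HW j; have [_ -> _] := HW (t - j).
have LP j p : p \in L j <->
    [/\ size p.1 = j, size p.2 = t - j & admissible j (label_of j p)].
  have [_ _ H] := HW j; have [_ _ H'] := HW (t - j); split.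
    move=> /allpairsP[[wl wr] /= [/H[s1 g1] /H'[s2 g2] ->]] /=.
    by split=> //; apply/admissible_label.
  case=> s1 s2 /(admissible_label s1 s2)[g1 g2].
  apply/allpairsP; exists p; split; [exact/H|exact/H'|exact: surjective_pairing].
pose cls (q : 'I_t.+1 * (seq nat * seq nat)) :=
  [set D : diagram t.+1 | marked q.1 (label_of q.1 q.2) D].
have cls_inj q q' : q.2 \in L q.1 -> q'.2 \in L q'.1 -> cls q = cls q' -> q = q'.
  case: q q' => [j p] [j' p'] /= /LP[s1 s2 a] /LP[s1' s2' _] e.
  have [D M] := marked_target_exists a.
  have M' : cls (j', p') D by rewrite -e.
  have /= [ej ed] := marked_uniq M M'; subst j'.
  by rewrite (label_of_inj s1 s2 s1' s2' ed).
have HsetE : Hset t.+1 = [set cls q | q in [set q | q.2 \in L q.1]].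
  apply/seteqP; split=> [E [D ->]|E [[j p] /= pL <-]].
    have [j [d M]] := marked_exists D; have [p [s1 s2 e]] := label_of_surj j d.
    have {}M : marked j (label_of j p) D by apply: marked_ext M => i ij; rewrite e.
    exists (j, p); last by rewrite (diagram_classE M).
    by apply/LP; split=> //; apply: marked_admissible M.
  have [_ _ /marked_target_exists[D M]] := (LP j p).1 pL.
  by exists D; rewrite (diagram_classE M).
have Hset_atE j : Hset_at j = [set cls (j, p) | p in [set` L j]].
  apply/seteqP; split=> [E [+ sj]|E [p pL <-]].
    rewrite HsetE => -[[j' p] /= pL eE]; subst E.
    have [_ _ /marked_target_exists[D M]] := (LP j' p).1 pL.
    have ej := strongly_extremal_uniq (sj D M) M.1; subst j'.
    by exists p.
  split; first by rewrite HsetE; exists (j, p).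
  by move=> D [].
split.
  pose LL := [seq (j, p) | j <- enum 'I_t.+1, p <- L j].
  have -> : catalan t.+1 = size LL.
    (* The sum over all positions [j] is the Segner recurrence. *)
    rewrite size_allpairs_dep sumnE big_map big_enum /= catalan_Segner.
    by apply: eq_bigr => j _; rewrite sL.
  have LLP q : q \in LL = (q.2 \in L q.1).
    apply/allpairsPdep/idP => [[j [p [_ pL ->]]] //|qL].
    by exists q.1, q.2; rewrite mem_enum -surjective_pairing.
  rewrite HsetE (_ : [set q | _] = [set` LL]); last first.
    by apply/seteqP; split=> q /=; rewrite LLP.
  apply: card_image_seq => [|q q']; last by rewrite !LLP; apply: cls_inj.
  apply: allpairs_uniq_dep => [|j _|]; [exact: enum_uniq|exact: uL|].
  by move=> [j p] [j' p'] _ _ /= [-> ->].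
move=> j; rewrite -sL Hset_atE; apply: card_image_seq => // p p' pL pL' e.
by have [] := cls_inj (j, p) (j, p') pL pL' e.
Qed.
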